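(* There exists a tree of radius $3$ that is planar avoidable, and there exists a tree of radius $2$ that is outerplanar avoidable.
   Context: A graph $H$ is planar avoidable if for every planar graph $G$ there is a coloring of the edges of $G$ with two colors (red and blue) containing no monochromatic copy of $H$ (a subgraph isomorphic to $H$ all of whose edges have the same color). Similarly, $H$ is outerplanar avoidable if for every outerplanar graph $G$ there is a red/blue edge-coloring of $G$ with no monochromatic copy of $H$. *)

(* Defs.v *)
From HB Require Import structures.
From mathcomp Require Import all_boot all_order all_algebra.
From mathcomp Require Import all_classical all_reals all_analysis.

Set Implicit Arguments.
Unset Strict Implicit.
Unset Printing Implicit Defensive.

Import Order.TTheory GRing.Theory Num.Theory.
Import numFieldNormedType.Exports.

Record sgraph := SGraph {
  vertex :> finType;
  adj : rel vertex;
  adj_sym : symmetric adj;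
  adj_irr : irreflexive adj }.

Definition edge (G : sgraph) (x y : G) : {set G} := [set x; y]%SET.

Definition edges (G : sgraph) : {set {set G}} :=
  [set edge p.1 p.2 | p : G * G & adj p.1 p.2]%SET.

Definition connected_graph (G : sgraph) : Prop :=
  0 < #|G| /\ forall x y : G, connect (@adj G) x y.

(* [ucycle] accepts the empty sequence and, for every edge xy, the sequence
   [:: x; y]; the genuine cycles are those with at least three vertices. *)
Definition acyclic_graph (G : sgraph) : Prop :=
  forall c : seq G, ucycle (@adj G) c -> size c < 3.

Definition is_tree (G : sgraph) : Prop := connected_graph G /\ acyclic_graph G.

Definition has_walk (G : sgraph) (x y : G) (n : nat) : bool :=
  [exists p : n.-tuple G, path (@adj G) x p && (last x p == y)].

(* Least length of a walk from x to y.  Distances between connected vertices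
   are smaller than #|G|; the value is #|G| when x and y are not connected. *)
Definition graph_dist (G : sgraph) (x y : G) : nat :=
  find (has_walk x y) (iota 0 #|G|).

Definition eccentricity (G : sgraph) (x : G) : nat := \max_(y : G) graph_dist x y.

(* The neutral element #|G| is an upper bound of every eccentricity. *)
Definition graph_radius (G : sgraph) : nat :=
  \big[minn/#|G|]_(x : G) eccentricity x.

(* An edge colouring assigns one of two colours to the two-element sets which
   are edges; its values on other sets of vertices are never used. *)
Definition mono_copy (H G : sgraph) (c : {set G} -> bool) : Prop :=
  exists (f : H -> G) (col : bool),
    injective f /\
    forall x y : H, adj x y ->
      adj (f x) (f y) /\ c (edge (f x) (f y)) = col.

Local Open Scope classical_set_scope.
Local Open Scope ring_scope.

Definition is_arc (R : realType) (A : set (R * R)) (p q : R * R) : Prop :=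
  exists g : R -> R * R,
    [/\ {within `[0, 1], continuous g},
        {in `[0, 1] &, injective g},
        g 0 = p, g 1 = q & A = g @` `[0, 1]].

Record is_drawing (R : realType) (G : sgraph)
    (pos : G -> R * R) (arc : {set G} -> set (R * R)) : Prop := IsDrawing {
  drawing_inj : injective pos;
  drawing_arc : forall x y : G, adj x y ->
    is_arc (arc (edge x y)) (pos x) (pos y);
  drawing_vertex : forall (e : {set G}) (z : G), e \in edges G ->
    arc e (pos z) -> z \in e;
  drawing_cross : forall e f : {set G}, e \in edges G -> f \in edges G ->
    e != f -> forall p, arc e p -> arc f p ->
    exists z : G, [/\ z \in e, z \in f & p = pos z] }.

Definition drawing_points (R : realType) (G : sgraph)
    (pos : G -> R * R) (arc : {set G} -> set (R * R)) : set (R * R) :=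
  range pos `|` \bigcup_(e in [set` edges G]) arc e.

Definition is_outer_face (R : realType) (D F : set (R * R)) : Prop :=
  (exists2 p, (~` D) p & F = connected_component (~` D) p) /\ ~ bounded_set F.

Definition planar (R : realType) (G : sgraph) : Prop :=
  exists (pos : G -> R * R) (arc : {set G} -> set (R * R)),
    is_drawing pos arc.

(* The outer face is open and disjoint from the drawing, so a vertex lies on its
   boundary as soon as it lies in its closure. *)
Definition outerplanar (R : realType) (G : sgraph) : Prop :=
  exists (pos : G -> R * R) (arc : {set G} -> set (R * R)),
    is_drawing pos arc /\
    exists F : set (R * R), is_outer_face (drawing_points pos arc) F /\
      forall x : G, closure F (pos x).

Definition planar_avoidable (R : realType) (H : sgraph) : Prop :=
  forall G : sgraph, planar R G ->
    exists c : {set G} -> bool, ~ mono_copy H c.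

Definition outerplanar_avoidable (R : realType) (H : sgraph) : Prop :=
  forall G : sgraph, outerplanar R G ->
    exists c : {set G} -> bool, ~ mono_copy H c.

(* Main.v *)
(* The edges of a K_{3,3}-minor-free graph split into a 2-degenerate graph and a
   graph of bounded degree. Hence there are a proper 3-colouring phi of the
   2-degenerate part and an orientation of it such that every vertex has boundedly
   many neighbours other than its out-neighbours. Colour an oriented
   edge xy according to whether phi x < phi y. A monochromatic copy of a tree
   with large branching contains a directed path from its root to a leaf, on
   which phi is strictly monotone, so its depth is at most 2. For
   outerplanar graphs the same argument works with 2 colours, because a graph
   stays K_{3,3}-minor-free when an apex is added in the outer face.

   The decomposition removes, one after the other, vertices of degree at most 2
   and light edges (both ends of bounded degree). If there were neither, the
   vertices of small degree would be independent, of degree at least 3, and would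
   outnumber the others by a large factor; as K_{3,3}-minor-free graphs are
   sparse (Mader), contracting some of them into neighbours would produce three
   of them with three common neighbours.

   That planar graphs have no K_{3,3} minor is proved without the Jordan curve
   theorem, by a parity count of the winding of differences of points on
   independent edges. *)
Require Import Defs.
From Stdlib Require Import Ring.
From mathcomp Require Import all_boot zify.

Set Implicit Arguments.
Unset Strict Implicit.
Unset Printing Implicit Defensive.

(** * Sparsity of graphs without a K33 minor *)

Section Minors.
Variables (V : finType) (e : rel V).
Hypothesis e_sym : symmetric e.

Definition connected_in (A : {set V}) : Prop :=
  {in A &, forall x y, connect [rel u v | [&& u \in A, v \in A & e u v]] x y}.

Definition touch (A B : {set V}) : bool := [exists x in A, exists y in B, e x y].

Definition K33_minor : Prop := exists A B : 'I_3 -> {set V},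
  [/\ forall i, [/\ A i != set0, B i != set0, connected_in (A i) & connected_in (B i)],
      forall i j, i != j -> [disjoint A i & A j] /\ [disjoint B i & B j],
      forall i j, [disjoint A i & B j] &
      forall i j, touch (A i) (B j)].

Lemma touchP (A B : {set V}) :
  reflect (exists x y, [/\ x \in A, y \in B & e x y]) (touch A B).
Proof.
apply: (iffP exists_inP) => [[x xA /exists_inP[y yB exy]]|[x [y [xA yB exy]]]].
  by exists x, y.
by exists x => //; apply/exists_inP; exists y.
Qed.

Lemma touch_sym A B : touch A B = touch B A.
Proof.
apply/touchP/touchP => -[x [y [xA yB exy]]]; exists y, x; split=> //; by rewrite e_sym.
Qed.

Lemma touchS (A B C D : {set V}) :
  A \subset C -> B \subset D -> touch A B -> touch C D.
Proof.
move=> /subsetP AC /subsetP BD /touchP[x [y [xA yB exy]]].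
by apply/touchP; exists x, y; split; [apply: AC | apply: BD |].
Qed.

Lemma touchUl (A B C : {set V}) : touch (A :|: B) C = touch A C || touch B C.
Proof.
apply/idP/orP=> [/touchP[x [y []]]|].
  by rewrite inE => /orP[] xA yC exy; [left|right]; apply/touchP; exists x, y.
by case; apply: touchS; rewrite // ?subsetUl ?subsetUr.
Qed.

Lemma connected_in1 x : connected_in [set x].
Proof. by move=> y z /set1P-> /set1P->. Qed.

Lemma connected_inU A B :
  connected_in A -> connected_in B -> touch A B -> connected_in (A :|: B).
Proof.
move=> cA cB /touchP[a [b [aA bB eab]]].
set E := [rel u v | [&& u \in A :|: B, v \in A :|: B & e u v]].
have sE : connect_sym E.
  by apply: sym_connect_sym => u v /=; rewrite e_sym andbCA.
have mono (C : {set V}) : C \subset A :|: B -> connected_in C ->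
    {in C &, forall x y, connect E x y}.
  move=> /subsetP CAB cC x y xC yC.
  apply: connect_sub (cC x y xC yC) => u v /= /and3P[uC vC euv].
  by apply: connect1; rewrite /= !CAB.
have mA := mono A (subsetUl _ _) cA; have mB := mono B (subsetUr _ _) cB.
have cab : connect E a b by apply: connect1; rewrite /= !inE aA bB eab orbT.
have toa x : x \in A :|: B -> connect E x a.
  rewrite inE => /orP[xA|xB]; first exact: mA.
  by apply: connect_trans (mB _ _ xB bB) _; rewrite sE.
move=> x y xAB yAB; apply: connect_trans (toa _ xAB) _.
by rewrite sE toa.
Qed.

End Minors.

(** For symmetric irreflexive [q], twice the number of edges of the graph induced on [J]. *)
Definition degree_sum (I : finType) (q : rel I) (J : {set I}) : nat :=
  \sum_(x in J) #|[set y in J | q x y]|.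

Lemma degree_sumU1 (I : finType) (q : rel I) (J : {set I}) x :
  symmetric q -> irreflexive q -> x \notin J ->
  degree_sum q (x |: J) = degree_sum q J + 2 * #|[set y in J | q x y]|.
Proof.
move=> qs qi xJ; rewrite /degree_sum big_setU1 //=.
have -> : [set y in x |: J | q x y] = [set y in J | q x y].
  by apply/setP=> y; rewrite !inE; case: eqP => [->|]; rewrite ?qi ?andbF.
have -> : \sum_(i in J) #|[set y in x |: J | q i y]| =
          \sum_(i in J) (#|[set y in J | q i y]| + q x i).
  apply: eq_bigr => i iJ.
  have -> : [set y in x |: J | q i y] =
      (if q x i then [set x] else set0) :|: [set y in J | q i y].
    apply/setP=> y; rewrite !inE; case: ifP => qxi; rewrite !inE; case: eqP => //= ->.
      by rewrite qs qxi.
    by rewrite qs qxi andbF.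
  case: ifP => _; last by rewrite set0U addn0.
  by rewrite cardsU1 !inE (negPf xJ) /= addnC.
rewrite big_split /= mul2n -addnn addnCA; congr (_ + (_ + _)).
rewrite -big_mkcondr /= sum1_card; apply: eq_card => y; by rewrite !inE.
Qed.

Lemma degree_sum_ge (I : finType) (q : rel I) (J : {set I}) d :
  {in J, forall x, d <= #|[set y in J | q x y]|} -> d * #|J| <= degree_sum q J.
Proof.
move=> h; rewrite mulnC -sum_nat_const; exact: leq_sum.
Qed.

(** * Mader's bound: dense graphs have large clique minors *)

Section Mader.
Variables (V : finType) (e : rel V).
Hypothesis e_sym : symmetric e.

(** [F] lists the branch sets of a minor whose adjacency is [quotient_rel]. *)
Definition minor_family (I : finType) (J : {set I}) (F : I -> {set V}) : Prop :=
  [/\ {in J, forall x, F x != set0}, {in J, forall x, connected_in e (F x)} &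
      {in J &, forall x y, x != y -> [disjoint F x & F y]}].

Definition quotient_rel (I : finType) (F : I -> {set V}) : rel I :=
  [rel x y | (x != y) && touch e (F x) (F y)].

(** When one more branch set is joined to the clique, containing some [F x] yields adjacency to it,
    and lying in the union of the [F x] yields disjointness. *)
Definition clique_minor (I : finType) (J : {set I}) (F : I -> {set V}) t : Prop :=
  exists S : 'I_t -> {set V},
  [/\ forall i, connected_in e (S i),
      forall i, exists2 x, x \in J & F x \subset S i,
      forall i, S i \subset \bigcup_(x in J) F x &
      forall i j, i != j -> [disjoint S i & S j] && touch e (S i) (S j)].

Lemma quotient_rel_sym (I : finType) (F : I -> {set V}) : symmetric (quotient_rel F).
Proof. by move=> x y; rewrite /quotient_rel /= eq_sym touch_sym. Qed.

Lemma quotient_rel_irr (I : finType) (F : I -> {set V}) : irreflexive (quotient_rel F).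
Proof. by move=> x; rewrite /quotient_rel /= eqxx. Qed.

Lemma disjointUl (T : finType) (A B C : {set T}) :
  [disjoint A & C] -> [disjoint B & C] -> [disjoint A :|: B & C].
Proof. by rewrite -!setI_eq0 setIUl => /eqP-> /eqP->; rewrite setU0. Qed.

Section Merge.
Variables (I : finType) (J : {set I}) (F : I -> {set V}) (x y : I).
Hypotheses (wf : minor_family J F) (xJ : x \in J) (yJ : y \in J).
Hypothesis qxy : quotient_rel F x y.

Definition merge (z : I) : {set V} := if z == x then F x :|: F y else F z.

Lemma minor_family_merge : minor_family (J :\ y) merge.
Proof.
have [ne cn dj] := wf; have /andP[xny txy] := qxy.
split.
- move=> z /setD1P[zy zJ]; rewrite /merge; case: (z == x); last exact: ne.
  by rewrite setU_eq0 negb_and ne.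
- move=> z /setD1P[zy zJ]; rewrite /merge; case: (z == x); last exact: cn.
  by apply: connected_inU => //; apply: cn.
- move=> z w /setD1P[zy zJ] /setD1P[wy wJ] zw; rewrite /merge.
  case: (eqVneq z x) => [zx|zx]; case: (eqVneq w x) => [wx|wx].
  + by rewrite zx wx eqxx in zw.
  + by apply: disjointUl; apply: dj; rewrite // eq_sym.
  + by rewrite disjoint_sym; apply: disjointUl; apply: dj; rewrite // eq_sym.
  + exact: dj.
Qed.

Lemma sub_merge z : F z \subset merge z.
Proof. by rewrite /merge; case: eqP => [->|_] //; apply: subsetUl. Qed.

Lemma clique_minor_merge t : clique_minor (J :\ y) merge t -> clique_minor J F t.
Proof.
case=> S [cS iS sS dS]; exists S; split=> //.
  move=> i; have [z /setD1P[_ zJ] zS] := iS i; exists z => //.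
  exact: subset_trans (sub_merge z) zS.
move=> i; apply: subset_trans (sS i) _; apply/bigcupsP => z /setD1P[_ zJ].
rewrite /merge; case: eqP => _; last exact: bigcup_sup.
by rewrite subUset !bigcup_sup.
Qed.

(** Contracting [x y] loses this edge and identifies the two edges to each common neighbour; every
    edge counts twice. *)
Lemma degree_sum_merge :
  degree_sum (quotient_rel F) J =
  degree_sum (quotient_rel merge) (J :\ y) + 2
  + 2 * #|[set z in J | quotient_rel F x z && quotient_rel F y z]|.
Proof.
have /andP[xny txy] := qxy.
set N := J :\ y :\ x; set q := quotient_rel F.
have qs : symmetric q := quotient_rel_sym F.
have qi : irreflexive q := quotient_rel_irr F.
have JE : J = y |: (x |: N) by rewrite setD1K ?setD1K // !inE xny xJ.
have JyE : J :\ y = x |: N by rewrite setD1K // !inE xny xJ.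
have xN : x \notin N by rewrite !inE eqxx.
have yN : y \notin x |: N by rewrite !inE eqxx /= andbF orbF eq_sym.
have yN' : y \notin N by rewrite !inE eqxx /= andbF.
rewrite JyE (degree_sumU1 (quotient_rel_sym _) (quotient_rel_irr _) xN).
rewrite [in LHS]JE (degree_sumU1 qs qi yN) (degree_sumU1 qs qi xN).
have -> : degree_sum (quotient_rel merge) N = degree_sum q N.
  apply: eq_bigr => z zN; congr #|pred_of_set _|; apply/setP => w; rewrite !inE.
  case: (eqVneq w x) => [//|wx]; move: zN; rewrite !inE => /andP[zx _].
  by rewrite /quotient_rel /= /merge (negPf zx) (negPf wx).
have -> : [set z in x |: N | q y z] = x |: [set z in N | q y z].
  by apply/setP=> z; rewrite !inE; case: (eqVneq z x) => [->|//]; rewrite qs /q qxy.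
rewrite cardsU1 !inE eqxx /=.
have -> : [set z in N | quotient_rel merge x z] =
          [set z in N | q x z] :|: [set z in N | q y z].
  apply/setP=> z; rewrite !inE /q /quotient_rel /= /merge eqxx.
  case: (eqVneq z x) => [->//|zx]; rewrite ?andbF //=.
  case: (eqVneq z y) => [->//|zy] /=; rewrite touchUl; by case: (z \in J).
have -> : [set z in J | q x z && q y z] = [set z in N | q x z] :&: [set z in N | q y z].
  apply/setP=> z; rewrite !inE; case: (eqVneq z x) => [->|zx] /=.
    by rewrite qi andbF.
  case: (eqVneq z y) => [->|zy] /=; first by rewrite qi !andbF.
  by case: (z \in J).
have := cardsUI [set z in N | q x z] [set z in N | q y z]; lia.
Qed.

End Merge.

(* Mader: contract edges as long as the density survives. When it no longer
   does, every edge lies in many triangles, so that the neighbourhood of a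
   vertex is dense and, by induction, has a large clique minor. *)
Lemma dense_clique_minor (I : finType) t (J : {set I}) (F : I -> {set V}) :
  minor_family J F -> J != set0 -> 2 ^ t * #|J| <= degree_sum (quotient_rel F) J ->
  clique_minor J F t.
Proof.
elim: t J F => [|t IHt] J F; first by exists (fun i => set0); split=> -[].
have [n] := ubnP #|J|; elim: n J F => // n IHn J F /ltnSE leJn wf J0 dense.
have [ne cn dj] := wf.
have [x xJ [y yJ qxy]] : exists2 x, x \in J & exists2 y, y \in J & quotient_rel F x y.
  have : 0 < degree_sum (quotient_rel F) J.
    by apply: leq_trans dense; rewrite muln_gt0 expn_gt0 card_gt0.
  rewrite /degree_sum lt0n sum_nat_eq0 negb_forall => /existsP[x].
  rewrite negb_imply -lt0n card_gt0 => /andP[xJ /set0Pn[y]].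
  by rewrite inE => /andP[yJ qxy]; exists x => //; exists y.
case: (boolP [exists a in J, exists b in J, quotient_rel F a b &&
   (2 ^ t.+1 * #|J :\ b| <= degree_sum (quotient_rel (merge F a b)) (J :\ b))]).
  move=> /exists_inP[a aJ /exists_inP[b bJ /andP[qab dens']]].
  apply: (@clique_minor_merge _ _ _ a b aJ bJ t.+1).
  have cJ : #|J :\ b| < #|J| by rewrite [X in _ < X](cardsD1 b) bJ.
  apply: IHn => //; first exact: leq_trans cJ leJn.
    exact: minor_family_merge.
  have /andP[ab _] := qab.
  by apply/set0Pn; exists a; rewrite !inE ab.
move=> nomerge.
have common a b : a \in J -> b \in J -> quotient_rel F a b ->
    2 ^ t <= #|[set z in J | quotient_rel F a z && quotient_rel F b z]|.
  move=> aJ bJ qab; have E := degree_sum_merge aJ bJ qab.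
  have : ~~ (2 ^ t.+1 * #|J :\ b| <= degree_sum (quotient_rel (merge F a b)) (J :\ b)).
    apply: contra nomerge => h; apply/exists_inP; exists a => //.
    by apply/exists_inP; exists b => //; rewrite qab.
  (* A contraction after which the density is below [2 ^ t.+1] loses more than [2 ^ t.+1] from the
     degree sum, so [a] and [b] have at least [2 ^ t] common neighbours. *)
  move: dense; rewrite E [in X in X -> _](cardsD1 b) bJ expnS.
  nia.
(* The graph on the neighbours of [x] has minimum degree at least [2 ^ t]; induction gives a clique
   there, to which [F x] is added. *)
pose J' := [set z in J | quotient_rel F x z].
have J'J : J' \subset J by apply/subsetP=> z; rewrite inE => /andP[].
have wf' : minor_family J' F.
  have /subsetP sJ := J'J; split.
  - by move=> z /sJ; apply: ne.
  - by move=> z /sJ; apply: cn.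
  - by move=> z w /sJ zJ /sJ wJ; apply: dj.
have [||S [cS iS sS dS]] := IHt _ _ wf'.
- by apply/set0Pn; exists y; rewrite inE yJ.
- apply: degree_sum_ge => z; rewrite inE => /andP[zJ qxz].
  apply: leq_trans (common x z xJ zJ qxz) _; apply: subset_leq_card.
  by apply/subsetP => w; rewrite !inE andbA.
have sub i : S i \subset \bigcup_(z in J) F z.
  by apply: subset_trans (sS i) _; apply/bigcupsP => z /(subsetP J'J) zJ; apply: bigcup_sup.
have dSx i : [disjoint S i & F x].
  apply: disjointWl (sS i) _; rewrite disjoint_sym; apply: bigcup_disjoint => z.
  by rewrite inE => /andP[zJ /andP[xz _]]; apply: dj.
have tSx i : touch e (S i) (F x).
  have [z] := iS i; rewrite inE => /andP[zJ /andP[_ txz]] zS.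
  by rewrite touch_sym //; apply: touchS txz.
exists (fun i => if unlift ord0 i is Some j then S j else F x); split.
- by move=> i; case: unliftP => [j|] _; [apply: cS | apply: cn].
- move=> i; case: unliftP => [j|] _; last by exists x.
  by have [z /(subsetP J'J) zJ zS] := iS j; exists z.
- by move=> i; case: unliftP => [j|] _ //; apply: bigcup_sup.
- move=> i j; case: unliftP => [i'|] ->; case: unliftP => [j'|] ->; rewrite ?eqxx //.
  + by rewrite (inj_eq lift_inj) => /dS.
  + by move=> _; rewrite dSx tSx.
  + by move=> _; rewrite disjoint_sym dSx touch_sym // tSx.
Qed.

(** A clique minor with six branch sets contains K_{3,3}: the first three sets against the last
    three. *)
Lemma K33_minor_free_sparse (I : finType) (J : {set I}) (F : I -> {set V}) :
  ~ K33_minor e -> minor_family J F -> J != set0 ->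
  degree_sum (quotient_rel F) J < 2 ^ 6 * #|J|.
Proof.
move=> noK wf J0; rewrite ltnNge; apply/negP => /(dense_clique_minor wf J0).
case=> S [cS iS _ dS]; apply: noK; have [ne _ _] := wf.
exists (fun i : 'I_3 => S (@lshift 3 3 i)), (fun i : 'I_3 => S (@rshift 3 3 i)).
have neS i : S i != set0.
  have [x xJ /subset_leq_card] := iS i; rewrite -!card_gt0; apply: leq_trans.
  by rewrite card_gt0 ne.
split=> [i|i j ij|i j|i j]; first by split.
- split.
    by have /dS/andP[] : @lshift 3 3 i != lshift 3 j by rewrite eq_lshift.
  by have /dS/andP[] : @rshift 3 3 i != rshift 3 j by rewrite eq_rshift.
- by have /dS/andP[] : @lshift 3 3 i != rshift 3 j by rewrite eq_lrshift.
- by have /dS/andP[] : @lshift 3 3 i != rshift 3 j by rewrite eq_lrshift.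
Qed.

End Mader.

(** * Light edges *)

Definition degree (V : finType) (e : rel V) (x : V) : nat := #|[set y | e x y]|.

(** Isolated vertices are excluded because deleting them removes no edge. *)
Definition light (n l : nat) (V : finType) (e : rel V) : Prop :=
  (exists x, 0 < degree e x < n) \/
  (exists x y, [/\ e x y, degree e x <= l & degree e y <= l]).

Lemma leq_card_bigcup (I T : finType) (A : {set I}) (F : I -> {set T}) m :
  {in A, forall i, #|F i| <= m} -> #|\bigcup_(i in A) F i| <= m * #|A|.
Proof.
move=> h; rewrite mulnC -sum_nat_const.
apply: leq_trans (_ : \sum_(i in A) #|F i| <= _); last exact: leq_sum.
elim/big_ind2: _ => [|B k C l hB hC|//]; first by rewrite cards0.
by apply: leq_trans (leq_card_setU _ _) _; apply: leq_add.
Qed.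

Section LightEdge.
Variables (V : finType) (e : rel V).
Hypotheses (e_sym : symmetric e) (e_irr : irreflexive e).
Hypothesis noK33 : ~ K33_minor e.

Lemma K33_subgraph (a b : 'I_3 -> V) :
  injective a -> injective b -> ~ (forall i j, e (a i) (b j)).
Proof.
move=> ia ib eab; apply: noK33.
exists (fun i => [set a i]), (fun i => [set b i]); split.
- move=> i; split; try exact: connected_in1.
    by apply/set0Pn; exists (a i); rewrite inE.
  by apply/set0Pn; exists (b i); rewrite inE.
- by move=> i j ij; rewrite !disjoints1 !inE (inj_eq ia) (inj_eq ib).
- move=> i j; rewrite disjoints1 inE; apply/eqP => E.
  by have := eab i j; rewrite E e_irr.
- by move=> i j; apply/touchP; exists (a i), (b j); rewrite !inE !eqxx.
Qed.

Lemma card_common_neighbours x y z :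
  x != y -> x != z -> y != z -> #|[set w | [&& e w x, e w y & e w z]]| <= 2.
Proof.
move=> xy xz yz; rewrite leqNgt; apply/negP => /card_gt2P[a [b [c [[]]]]].
rewrite !inE => /and3P[ax ay az] /and3P[bx b_y bz] /and3P[cx cy cz] [ab bc ca].
have t3 (u v w : V) : u != v -> v != w -> w != u -> injective (tnth [tuple u; v; w]).
  move=> uv vw wu; apply/tuple_uniqP; by rewrite /= !inE !negb_or uv vw [u == w]eq_sym wu.
apply: (K33_subgraph (t3 a b c ab bc ca) (t3 x y z xy yz _)).
  by rewrite eq_sym.
move=> i j.
have /(all_nthP x) H : all (fun u => all (e u) [:: x; y; z]) [:: a; b; c].
  by rewrite /= ax ay az bx b_y bz cx cy cz.
rewrite (tnth_nth a) (tnth_nth x).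
have /(all_nthP x) := H i (ltn_ord i); rewrite (set_nth_default a) //.
by apply.
Qed.

(** Remove from [J] a vertex [x] of [q]-degree below [d]. Each [w] adjacent to [x] has two more
    neighbours [y], [z] in [J], both [q]-neighbours of [x]; there are at most [d * d] pairs
    [(y, z)], and at most 2 vertices see all of [x], [y], [z]. The other [w] keep their neighbours,
    so induction applies to them. *)
Lemma card_clique_neighbourhoods d (q : rel V) (J W : {set V}) :
  irreflexive q ->
  (forall J' : {set V}, J' \subset J -> J' != set0 ->
     exists2 x, x \in J' & #|[set y in J' | q x y]| < d) ->
  {in W, forall w, 2 < #|[set y in J | e w y]|} ->
  {in W, forall w, {in J &, forall x y, e w x -> e w y -> x != y -> q x y}} ->
  #|W| <= 2 * (d * d) * #|J|.
Proof.
move=> qi; have [n] := ubnP #|J|; elim: n J W => // n IHn J W /ltnSE leJn degen W3 Wq.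
have [J0|J0] := eqVneq J set0.
  suff -> : W = set0 by rewrite cards0.
  apply/eqP; rewrite -subset0; apply/subsetP => w /W3.
  by rewrite (_ : [set y in J | e w y] = set0) ?cards0 //; apply/setP=> y; rewrite J0 !inE.
have [x xJ degx] := degen J (subxx _) J0.
set Jx := [set y in J | q x y] in degx.
pose Wx := [set w in W | e w x].
have cJ : #|J :\ x| < #|J| by rewrite [X in _ < X](cardsD1 x) xJ.
have leWx : #|Wx| <= 2 * (d * d).
  pose P := [set p in setX Jx Jx | p.1 != p.2].
  have leP : #|P| <= d * d.
    apply: leq_trans (_ : #|setX Jx Jx| <= _).
      by apply: subset_leq_card; apply/subsetP => p; rewrite inE => /andP[].
    by rewrite cardsX leq_mul // ltnW.
  apply: leq_trans (_ : 2 * #|P| <= _); last by rewrite leq_mul2l leP.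
  have fibre : {in P, forall p : V * V, #|[set w in Wx | e w p.1 && e w p.2]| <= 2}.
    move=> [y z]; rewrite !inE /= => /andP[/andP[/andP[yJ qxy] /andP[zJ qxz]] yz].
    have xy : x != y by apply: contraTneq qxy => <-; rewrite qi.
    have xz : x != z by apply: contraTneq qxz => <-; rewrite qi.
    apply: leq_trans (card_common_neighbours xy xz yz); apply: subset_leq_card.
    by apply/subsetP => w; rewrite !inE => /andP[/andP[_ ->]].
  apply: leq_trans (leq_card_bigcup fibre); apply: subset_leq_card.
  apply/subsetP => w; rewrite inE => /andP[wW ewx].
  have : 1 < #|[set y in J | e w y] :\ x|.
    by have := W3 w wW; rewrite (cardsD1 x) inE xJ ewx.
  case/card_gt1P => y [z []]; rewrite !inE => /and3P[yx yJ ewy] /and3P[zx zJ ewz] yz.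
  apply/bigcupP; exists (y, z); rewrite !inE /= ?wW ?ewx ?ewy //.
  rewrite yz yJ zJ !andbT /=; apply/andP; split; apply: (Wq w) => //; by rewrite eq_sym.
have leW' : #|W :\: Wx| <= 2 * (d * d) * #|J :\ x|.
  apply: IHn.
  - exact: leq_trans cJ leJn.
  - by move=> J' J'J; apply: degen; apply: subset_trans J'J (subD1set _ _).
  - move=> w; rewrite !inE => /andP[]; case: (boolP (w \in W)) => //= wW newx _.
    rewrite (_ : [set y in J :\ x | e w y] = [set y in J | e w y]) ?W3 //.
    by apply/setP => y; rewrite !inE; case: eqP => /= [->|//]; rewrite (negPf newx) andbF. 
  - move=> w; rewrite !inE => /andP[_ wW] y z /setD1P[_ yJ] /setD1P[_ zJ].
    exact: Wq.
have -> : #|W| = #|Wx| + #|W :\: Wx|.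
  rewrite -(cardsID Wx W); congr (_ + _); apply: eq_card => w.
  by rewrite !inE andbA andbb.
rewrite [#|J|](cardsD1 x) xJ mulnDr muln1; exact: leq_add.
Qed.

Section Assignment.
Variables (d : nat) (S B : {set V}).
Hypothesis sparse : forall (J : {set V}) (F : V -> {set V}),
  minor_family e J F -> J != set0 -> degree_sum (quotient_rel e F) J < d * #|J|.
Hypothesis SB : [disjoint S & B].
Hypothesis B0 : B != set0.

(** [Some b] means that the vertex is contracted into its neighbour [b], [None] that it is left
    alone. *)
Definition assignment (a : {ffun V -> option V}) : bool :=
  [forall w, if a w is Some b then [&& w \in S, b \in B & e w b] else true].

Definition block (a : {ffun V -> option V}) (b : V) : {set V} :=
  b |: [set w | a w == Some b].

Lemma assignmentP a w b : assignment a -> a w = Some b ->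
  [/\ w \in S, b \in B & e w b].
Proof. by move=> /forallP/(_ w) + aw; rewrite aw => /and3P[]. Qed.

Lemma block_family a : assignment a -> minor_family e B (block a).
Proof.
move=> va; split.
- by move=> b bB; apply/set0Pn; exists b; rewrite !inE eqxx.
- move=> b bB.
  set E := [rel u v | [&& u \in block a b, v \in block a b & e u v]].
  have sE : connect_sym E.
    by apply: sym_connect_sym => u v /=; rewrite e_sym andbCA.
  have tob x : x \in block a b -> connect E x b.
    rewrite in_setU1 => /orP[/eqP->//|xa]; apply: connect1 => /=.
    rewrite setU11 in_setU1 xa orbT /=; move: xa; rewrite inE => /eqP xa.
    by have [] := assignmentP va xa.
  move=> x y xb yb; apply: connect_trans (tob x xb) _; by rewrite sE tob.
- move=> b c bB cB bc; rewrite -setI_eq0; apply/eqP/setP => w; rewrite !inE.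
  apply/negP => /andP[/orP[/eqP wb|/eqP awb] /orP[/eqP wc|/eqP awc]].
  + by rewrite -wb -wc eqxx in bc.
  + have [wS _ _] := assignmentP va awc.
    by rewrite -wb (disjointFr SB wS) in bB.
  + have [wS _ _] := assignmentP va awb.
    by rewrite -wc (disjointFr SB wS) in cB.
  + by move: awc; rewrite awb => -[bc']; rewrite bc' eqxx in bc.
Qed.

(* Maximising [weight] contracts vertices of S into B only where this creates
   a new adjacency in the quotient, so that few vertices are contracted and the
   others see pairwise adjacent blocks. *)
Definition weight (a : {ffun V -> option V}) : nat :=
  2 * degree_sum (quotient_rel e (block a)) B + #|[set w in S | a w == None]|.

(** Take [a] of maximal weight. Comparison with the empty assignment gives the bound on [#|S|]. If
    [w] saw two non-adjacent blocks, sending it to one of them would raise the degree sum, which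
    counts with factor 2, and lose only 1 in the other term. *)
Lemma exists_saturated_assignment : exists2 a, assignment a &
  [/\ #|S| <= 2 * degree_sum (quotient_rel e (block a)) B
              + #|[set w in S | a w == None]| &
      {in [set w in S | a w == None], forall w, {in B &, forall x y,
         e w x -> e w y -> x != y -> quotient_rel e (block a) x y}}].
Proof.
pose a0 : {ffun V -> option V} := [ffun=> None].
have va0 : assignment a0 by apply/forallP => w; rewrite ffunE.
have [a va amax] := @arg_maxnP _ a0 assignment weight va0.
exists a => //; split.
  apply: leq_trans (amax a0 va0); apply: leq_trans (leq_addl _ _).
  by apply: subset_leq_card; apply/subsetP=> w wS; rewrite inE wS ffunE.
move=> w; rewrite inE => /andP[wS /eqP aw] x y xB yB ewx ewy xy.
apply/andP; split=> //; apply: contraT => ntouch.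
pose a' : {ffun V -> option V} := [ffun z => if z == w then Some x else a z].
have va' : assignment a'.
  apply/forallP => z; rewrite ffunE; case: eqP => [->|_].
    by rewrite wS xB ewx.
  by have /forallP := va.
have bS b : block a b \subset block a' b.
  apply/subsetP => z; rewrite !inE ffunE; case: (eqVneq z w) => [->|//].
  by rewrite aw orbF => ->.
have qS : subrel (quotient_rel e (block a)) (quotient_rel e (block a')).
  by move=> b c /andP[bc t]; rewrite /quotient_rel /= bc; apply: touchS t.
have qxy : quotient_rel e (block a') x y.
  rewrite /quotient_rel /= xy; apply/touchP; exists w, y.
  by rewrite !inE ffunE !eqxx orbT.
have lt : degree_sum (quotient_rel e (block a)) B < degree_sum (quotient_rel e (block a')) B.
  rewrite /degree_sum (bigD1 x) //= [X in _ < X](bigD1 x) //= -addSn; apply: leq_add.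
    apply: proper_card; apply/properP; split.
      by apply/subsetP => z; rewrite !inE => /andP[-> /qS].
    by exists y; rewrite !inE yB ?qxy // /quotient_rel /= (negPf ntouch) andbF.
  apply: leq_sum => b _; apply: subset_leq_card.
  by apply/subsetP => z; rewrite !inE => /andP[-> /qS].
have un : #|[set z in S | a z == None]| = #|[set z in S | a' z == None]|.+1.
  rewrite (cardsD1 w) inE wS aw eqxx add1n; congr _.+1; apply: eq_card => z.
  by rewrite !inE ffunE; case: eqP => //= _; rewrite andbF.
have := amax a' va'; rewrite /weight un; move: lt.
set p := degree_sum _ _; set p' := degree_sum _ _; set k := #|_|.
by move: p p' k; clear; lia.
Qed.

(** The contracted vertices are bounded through the sparsity of the quotient. The others have
    cliques of the quotient as neighbourhoods in [B]; sparsity also gives every nonempty subfamily a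
    vertex of degree below [d], so [card_clique_neighbourhoods] applies. *)
Lemma card_light_vertices :
  {in S, forall w, 2 < #|[set y in B | e w y]|} -> #|S| <= 2 * (d + d * d) * #|B|.
Proof.
move=> S3; have [a va [leS clique]] := exists_saturated_assignment.
have lt := sparse (block_family va) B0.
have leW : #|[set w in S | a w == None]| <= 2 * (d * d) * #|B|.
  apply: (card_clique_neighbourhoods (quotient_rel_irr _ _) _ _ clique); last first.
    by move=> w; rewrite inE => /andP[/S3].
  move=> J /subsetP JB J0; apply/exists_inP; apply: contraT.
  rewrite negb_exists_in => /forall_inP many.
  have wf : minor_family e J (block a).
    have [ne cn dj] := block_family va; split.
    - by move=> z /JB; apply: ne.
    - by move=> z /JB; apply: cn.
    - by move=> z w /JB zJ /JB wJ; apply: dj.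
  have := sparse wf J0; rewrite ltnNge degree_sum_ge // => x xJ.
  by rewrite leqNgt many.
lia.
Qed.

End Assignment.
End LightEdge.

(** Otherwise the set [S] of vertices of positive degree at most [l] is independent and [#|S|] is at
    most [2 * (d + d * d) * #|B|]. The degree sum on [S :|: B] is then below [l * #|B|], by the
    choice of [l], although each vertex of [B] has degree above [l]. *)
Lemma K33_minor_free_light : exists2 l, 2 < l &
  forall (V : finType) (e : rel V), symmetric e -> irreflexive e ->
  ~ K33_minor e -> (exists x y, e x y) -> light 3 l e.
Proof.
have [d dgt1 sparse] : exists2 d, 1 < d & forall (V : finType) (e : rel V),
    symmetric e -> ~ K33_minor e ->
    forall (J : {set V}) (F : V -> {set V}), minor_family e J F -> J != set0 ->
    degree_sum (quotient_rel e F) J < d * #|J|.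
  by exists (2 ^ 6) => // V e es noK J F; apply: K33_minor_free_sparse.
exists (d * (1 + 2 * (d + d * d))); first nia.
move=> V e es ei noK [x0 [y0 exy0]]; set l := d * _.
have [/existsP[x degx]|nosmall] := boolP [exists x, 0 < degree e x < 3].
  by left; exists x.
have [/existsP[x /existsP[y /and3P[exy dx dy]]]|nolight] :=
    boolP [exists x, exists y, [&& e x y, degree e x <= l & degree e y <= l]].
  by right; exists x, y.
exfalso.
pose B := [set x | l < degree e x]; pose S := [set x | 0 < degree e x <= l].
have deg_gt0 x y : e x y -> 0 < degree e x.
  by move=> exy; rewrite card_gt0; apply/set0Pn; exists y; rewrite inE.
have SB : [disjoint S & B].
  by rewrite -setI_eq0; apply/eqP/setP => x; rewrite !inE [l < _]ltnNge -andbA andbN andbF.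
have heavy x y : e x y -> (x \in B) || (y \in B).
  move=> exy; rewrite !inE !ltnNge -negb_and; apply: contra nolight => /andP[dx dy].
  by apply/existsP; exists x; apply/existsP; exists y; rewrite exy dx dy.
have B0 : B != set0.
  by have /orP[] := heavy _ _ exy0 => xB; apply/set0Pn; [exists x0 | exists y0].
have S3 : {in S, forall w, 2 < #|[set y in B | e w y]|}.
  move=> w wS; have wB := disjointFr SB wS.
  have -> : #|[set y in B | e w y]| = degree e w.
    apply: eq_card => y; rewrite !inE; case: (boolP (e w y)) => ewy; rewrite ?andbF // andbT.
    by have := heavy _ _ ewy; rewrite wB /= inE.
  move: nosmall; rewrite negb_exists => /forallP/(_ w).
  by move: wS; rewrite inE => /andP[-> _] /=; rewrite -leqNgt.
have leS := card_light_vertices es ei noK (sparse _ _ es noK) SB B0 S3.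
have wf : minor_family e (S :|: B) (fun x => [set x]).
  split=> [x _|x _|x y _ _ xy].
  - by apply/set0Pn; exists x; rewrite inE.
  - exact: connected_in1.
  - by rewrite disjoints1 inE.
have SB0 : S :|: B != set0 by rewrite setU_eq0 negb_and B0 orbT.
have lt := sparse _ _ es noK _ _ wf SB0.
have ge : l.+1 * #|B| <= degree_sum (quotient_rel e (fun x => [set x])) (S :|: B).
  rewrite mulnC -sum_nat_const /degree_sum.
  apply: leq_trans (_ : \sum_(x in B) degree e x <= _).
    by apply: leq_sum => x; rewrite inE.
  rewrite [X in _ <= X](big_setID B) /= [_ :&: B]setIC setKU; apply: leq_trans (leq_addr _ _).
  apply: leq_sum => x xB; apply: subset_leq_card; apply/subsetP => y; rewrite inE => exy.
  have dy : 0 < degree e y by apply: (deg_gt0 y x); rewrite es.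
  rewrite !inE dy /= [l < _]ltnNge orbN /=; apply/andP; split.
    by apply: contraTneq exy => ->; rewrite ei.
  by apply/touchP; exists x, y; rewrite !inE.
have cU : #|S :|: B| <= #|S| + #|B| := leq_card_setU S B.
have cB : 0 < #|B| by rewrite card_gt0.
have := leq_mul (leqnn d) (leq_trans cU (leq_add leS (leqnn _))).
move/(leq_trans (ltnW lt))/(leq_trans ge).
by rewrite -[X in _ + X]mul1n -mulnDl mulnA addnC -/l mulSn -[X in _ <= X]add0n leq_add2r leqNgt cB.
Qed.

(** * Oriented colourings and trees *)

Section OrientedColouring.
Variables (n l : nat) (V : finType).

(** [g x y] orients an edge from [x] to [y]; some edges may stay unoriented. The last clause bounds
    incoming and unoriented edges together. *)
Definition oriented_colouring (e g : rel V) (phi : V -> nat) : Prop :=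
  [/\ forall x, phi x < n,
      forall x y, g x y -> e x y && (phi x != phi y),
      forall x y, g x y -> ~~ g y x &
      forall x, #|[set y | e x y && ~~ g x y]| <= l].

Lemma fresh_colour (phi : V -> nat) (A : {set V}) :
  #|A| < n -> exists2 c, c < n & {in A, forall x, phi x != c}.
Proof.
move=> ltAn; pose s := [seq phi x | x in A].
have [/hasP[c]|/hasPn h] := boolP (has (fun c => c \notin s) (iota 0 n)).
  rewrite mem_iota => /andP[_ ltc] cs; exists c => // x xA.
  by apply: contraNneq cs => <-; apply: image_f.
suff : n <= size s by rewrite size_image leqNgt ltAn.
rewrite -[X in X <= _](size_iota 0); apply: uniq_leq_size; first exact: iota_uniq.
by move=> c /h; rewrite negbK.
Qed.

(** Induction on the number of edges. The edges at a vertex of degree below [n] are oriented into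
    it, so its neighbours only gain out-neighbours, and it receives a fresh colour. A light edge
    stays unoriented, as both ends have at most [l] neighbours anyway. *)
Lemma light_oriented_colouring (e : rel V) :
  0 < n -> n <= l.+1 -> symmetric e -> irreflexive e ->
  (forall e' : rel V, subrel e' e -> symmetric e' ->
     (exists x y, e' x y) -> light n l e') ->
  exists g phi, oriented_colouring e g phi.
Proof.
move=> n0 nl; have [m] := ubnP #|[set p : V * V | e p.1 p.2]|.
elim: m e => // m IHm e /ltnSE lem es ei hl.
have [/existsP[x0 /existsP[y0 exy0]]|noedge] := boolP [exists x, exists y, e x y]; last first.
  exists (fun _ _ => false), (fun _ => 0); split=> // x.
  rewrite (_ : [set y | _] = set0) ?cards0 //; apply/setP => y; rewrite !inE andbT.
  by apply: contraNF noedge => exy; apply/existsP; exists x; apply/existsP; exists y.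
have IH (e' : rel V) x y : subrel e' e -> symmetric e' -> e x y -> ~~ e' x y ->
    exists g phi, oriented_colouring e' g phi.
  move=> se s' exy nexy; apply: IHm => //.
  - apply: leq_trans lem; apply: proper_card; apply/properP; split.
      by apply/subsetP => p; rewrite !inE; apply: se.
    by exists (x, y); rewrite inE.
  - by move=> z; apply/negP => /se; rewrite ei.
  - by move=> e'' s''; apply: hl => u v /s''/se.
have : light n l e by apply: hl => //; exists x0, y0.
case=> [[x /andP[dx0 dxn]]|[x [y [exy dx dy]]]].
- have /card_gt0P[y] := dx0; rewrite inE => exy.
  pose e' := [rel u v | [&& e u v, u != x & v != x]].
  have [||||g [phi [phin ge ga gl]]] := IH e' x y.
  + by move=> u v /andP[].
  + by move=> u v; rewrite /= es [X in _ && X]andbC.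
  + by [].
  + by rewrite /= eqxx andbF.
  have [c cn fresh] := fresh_colour phi dxn.
  exists (fun u v => g u v || ((v == x) && e u x)), (fun u => if u == x then c else phi u).
  split.
  + by move=> u; case: (u == x).
  + move=> u v /orP[/ge/andP[/and3P[-> /negPf-> /negPf->]]//|/andP[/eqP-> eux]].
    rewrite eux eqxx; case: (eqVneq u x) => [ux|_]; first by rewrite ux ei in eux.
    by rewrite fresh // inE es.
  + move=> u v /orP[guv|/andP[/eqP-> eux]]; rewrite negb_or.
      have /andP[/and3P[_ /negPf-> _] _] := ge _ _ guv.
      by rewrite (ga _ _ guv).
    have -> : (u == x) = false by apply: contraTF eux => /eqP->; rewrite ei.
    by rewrite andbT; apply/negP => /ge/andP[/and3P[]]; rewrite eqxx.
  + move=> u; case: (eqVneq u x) => [->|ux].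
      apply: leq_trans (_ : degree e x <= _); last by rewrite -ltnS; apply: leq_trans nl.
      by apply: subset_leq_card; apply/subsetP => v; rewrite !inE => /andP[].
    apply: leq_trans (gl u); apply: subset_leq_card; apply/subsetP => v.
    rewrite !inE negb_or /= ux /= => /and3P[euv -> ]; rewrite euv andbT /=.
    by apply: contra => /eqP vx; rewrite vx eqxx -{1}vx.
- pose xy u v := [|| (u == x) && (v == y) | (u == y) && (v == x)].
  have xys u v : xy u v = xy v u by rewrite /xy orbC ![(v == _) && _]andbC.
  pose e' := [rel u v | e u v && ~~ xy u v].
  have [||||g [phi [phin ge ga gl]]] := IH e' x y.
  + by move=> u v /andP[].
  + by move=> u v; rewrite /= es xys.
  + by [].
  + by rewrite /= /xy !eqxx andbF.
  have sub u : #|[set v | e u v && ~~ g u v]| <= degree e u.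
    by apply: subset_leq_card; apply/subsetP => v; rewrite !inE => /andP[].
  exists g, phi; split=> //; first by move=> u v /ge /andP[/andP[-> _]].
  move=> u; case: (eqVneq u x) => [->|ux]; first exact: leq_trans (sub x) dx.
  case: (eqVneq u y) => [->|uy]; first exact: leq_trans (sub y) dy.
  apply: leq_trans (gl u); apply: subset_leq_card; apply/subsetP => v.
  by rewrite !inE /= /xy (negPf ux) (negPf uy) andbT.
Qed.

End OrientedColouring.

(** * Distances and radius *)

Section Distance.
Variable G : sgraph.

Lemma has_walkP (x y : G) m :
  reflect (exists p, [/\ path (@adj G) x p, last x p = y & size p = m]) (has_walk x y m).
Proof.
apply: (iffP existsP) => [[p /andP[px /eqP lp]]|[p [px lp sp]]].
  by exists p; rewrite size_tuple.
have sp' : size p == m by apply/eqP.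
by exists (Tuple sp'); rewrite /= px lp eqxx.
Qed.

Lemma graph_dist_le (x y : G) m : has_walk x y m -> m < #|G| -> graph_dist x y <= m.
Proof.
move=> w ltm; rewrite leqNgt; apply/negP => lt.
by have := before_find 0 lt; rewrite nth_iota // w.
Qed.

Lemma graph_dist_ge (x y : G) m : m <= #|G| ->
  (forall p, path (@adj G) x p -> last x p = y -> m <= size p) -> m <= graph_dist x y.
Proof.
move=> lem h; rewrite leqNgt; apply/negP => lt.
have ltG := leq_trans lt lem.
have : has (has_walk x y) (iota 0 #|G|) by rewrite has_find size_iota.
move/(nth_find 0); rewrite nth_iota // add0n => /has_walkP[p [px lp sp]].
by move: (h p px lp); rewrite sp -/(graph_dist x y) leqNgt lt.
Qed.

Lemma graph_radiusP m : m <= #|G| -> (forall x : G, m <= eccentricity x) ->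
  (exists x : G, eccentricity x <= m) -> graph_radius G = m.
Proof.
move=> lem ge [x le]; apply/eqP; rewrite eqn_leq; apply/andP; split.
  apply: leq_trans le; rewrite /graph_radius.
  have : x \in index_enum G by rewrite mem_index_enum.
  elim: (index_enum G) => // y s IH; rewrite inE big_cons geq_min => /orP[/eqP->|/IH->].
    by rewrite leqnn.
  by rewrite orbT.
rewrite /graph_radius; elim/big_ind: _ => // a b ha hb; by rewrite leq_min ha hb.
Qed.

End Distance.

(** * Complete k-ary trees of depth n *)

Section KaryTree.
Variables n k : nat.

(* A vertex is a word of length at most n; its parent is obtained by deleting
   the first letter, and the last letter tells the branch at the root. *)
Definition kary_vertex : finType := n.-bseq 'I_k.

Definition child (s t : kary_vertex) : bool :=
  (size t == (size s).+1) && (behead t == s :> seq 'I_k).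

Definition kary_adj (s t : kary_vertex) : bool := child s t || child t s.

Lemma kary_adj_sym : symmetric kary_adj.
Proof. by move=> s t; rewrite /kary_adj orbC. Qed.

Lemma kary_adj_irr : irreflexive kary_adj.
Proof. by move=> s; rewrite /kary_adj orbb /child eqn_leq ltnn andbF. Qed.

Definition kary_tree : sgraph := SGraph kary_adj_sym kary_adj_irr.

Definition cons_vertex (i : 'I_k) (s : kary_vertex) (ltsn : size s < n) : kary_vertex :=
  Bseq (ltsn : size (i :: s) <= n).

Lemma child_cons i (s : kary_vertex) (ltsn : size s < n) : child s (cons_vertex i ltsn).
Proof. by rewrite /child /= !eqxx. Qed.

Definition root_vertex : kary_vertex := Bseq (leq0n n : size [::] <= n).

Lemma parent_vertex (t : kary_vertex) : 0 < size t -> exists s, child s t.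
Proof.
move=> t0; have hb : size (behead t) <= n.
  by rewrite size_behead; apply: leq_trans (leq_pred _) (size_bseq t).
by exists (Bseq hb); rewrite /child /= eqxx size_behead prednK ?eqxx.
Qed.

Lemma walk_to_root (t : kary_vertex) :
  exists p, [/\ path (@adj kary_tree) root_vertex p, last root_vertex p = t & size p = size t].
Proof.
have [m] := ubnP (size t); elim: m t => // m IHm t /ltnSE ltm.
have [s0|s0] := posnP (size t).
  exists [::]; split=> //; apply/val_inj => /=; by rewrite (size0nil s0).
have [s st] := parent_vertex s0; have /andP[/eqP sz _] := st.
have [|p [pp lp sp]] := IHm s; first by rewrite -sz.
exists (rcons p t); rewrite rcons_path last_rcons size_rcons pp lp sp sz; split=> //.
by rewrite /= /kary_adj /= st.
Qed.

Lemma kary_tree_connected : connected_graph kary_tree.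
Proof.
split; first by apply/card_gt0P; exists root_vertex.
have cs : connect_sym (@adj kary_tree) by apply: sym_connect_sym; apply: kary_adj_sym.
have toroot (t : kary_tree) : connect (@adj kary_tree) root_vertex t.
  by have [p [pp lp _]] := walk_to_root t; apply/connectP; exists p.
by move=> s t; apply: connect_trans (toroot t); rewrite cs.
Qed.

(* Both cycle neighbours of a deepest vertex of a cycle would be its parent. *)
Lemma kary_tree_acyclic : acyclic_graph kary_tree.
Proof.
move=> c /andP[cyc un]; rewrite ltnNge; apply/negP => sc.
have [x0 x0c] : exists x0, x0 \in c by case: c sc {cyc un} => // x c _; exists x; rewrite inE eqxx.
have [z zc zmax] : exists2 z, z \in c &
    forall w, w \in c -> size (w : kary_vertex) <= size (z : kary_vertex).
  have [z zc zm] := @arg_maxnP kary_tree x0 (mem c) (fun w => size (w : kary_vertex)) x0c.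
  by exists z.
have [i c' cE] := rot_to zc.
move: cyc un sc; rewrite -(rot_cycle i) -(rot_uniq i) -(size_rot i) cE.
have sub w : w \in z :: c' -> size (w : kary_vertex) <= size (z : kary_vertex).
  by rewrite -cE mem_rot; apply: zmax.
have par w : w \in z :: c' -> @adj kary_tree z w -> behead (z : kary_vertex) = w :> seq 'I_k.
  move=> /sub wz /orP[/andP[/eqP sw _]|/andP[_ /eqP]//].
  by rewrite sw ltnn in wz.
case: c' cE sub par => [|y [|w c'']] // cE sub par.
rewrite /= rcons_path => /and4P[zy _ _ lz] /and4P[_ + _ _] _.
have /val_inj <- : val (last w c'') = val y; last by rewrite mem_last.
have lin : last w c'' \in [:: z, y, w & c''] by rewrite 2!in_cons mem_last !orbT.
transitivity (behead (z : kary_vertex)); last by apply: par => //; rewrite !inE eqxx orbT.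
by symmetry; apply: par => //; rewrite (@adj_sym kary_tree).
Qed.

Lemma kary_tree_is_tree : is_tree kary_tree.
Proof. by split; [apply: kary_tree_connected | apply: kary_tree_acyclic]. Qed.

(* Signed depth, shifted by n: positive exactly in the branch c at the root. *)
Definition signed_depth (c : 'I_k) (s : kary_vertex) : nat :=
  if last c s == c then n + size s else n - size s.

(** The branch changes only at the root, whose signed depth is [n] for every [c]. *)
Lemma signed_depth_child c s t : child s t ->
  signed_depth c t <= (signed_depth c s).+1 /\ signed_depth c s <= (signed_depth c t).+1.
Proof.
move=> /andP[/eqP sz /eqP bt]; rewrite /signed_depth.
have := size_bseq t; rewrite sz.
have : s != [::] :> seq _ -> last c t = last c s.
  by rewrite -bt; case: (val t) => //= a [].
case: (val s =P [::]) => [->|_]; last by move=> -> //; case: eqP => _; lia.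
move=> _ /=; rewrite eqxx; case: eqP => _; lia.
Qed.

Lemma signed_depth_path c (s : kary_tree) p : path (@adj kary_tree) s p ->
  signed_depth c (last s p) <= signed_depth c s + size p.
Proof.
elim: p s => [|t p IH] s /=; first by rewrite addn0.
move=> /andP[st /IH h]; apply: leq_trans h _; rewrite addnS -addSn leq_add2r.
by have /orP[/(signed_depth_child c)[]|/(signed_depth_child c)[]] := st.
Qed.

Lemma kary_tree_radius : 1 < k -> graph_radius kary_tree = n.
Proof.
move=> k1.
(* The constant words of length 0 to [n] show that [n] stays below the default value [#|G|] of
   distances. *)
have ltG : n < #|kary_tree|.
  pose c0 : 'I_k := Ordinal (ltnW k1).
  have le (i : 'I_n.+1) : size (nseq i c0) <= n by rewrite size_nseq -ltnS.
  have inj : injective (fun i : 'I_n.+1 => Bseq (le i) : kary_tree).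
    by move=> i j /(congr1 (fun s : kary_vertex => size s)); rewrite /= !size_nseq => /val_inj.
  by have := leq_card _ inj; rewrite card_ord.
apply: graph_radiusP; first exact: ltnW.
(* Choose a branch [c] not containing [s]; its vertex of depth [n] has signed depth [n + n], hence
   is at distance at least [n] from [s]. *)
- move=> s; have [c hc] : exists c : 'I_k, signed_depth c s <= n.
    case E : (val s) => [|a s'].
      by exists (Ordinal (ltnW k1)); rewrite /signed_depth E eqxx addn0.
    have [c ca] : exists c : 'I_k, last a s' != c.
      case: (eqVneq (last a s') (Ordinal k1)) => [->|ne]; last by exists (Ordinal k1).
      by exists (Ordinal (ltnW k1)).
    by exists c; rewrite /signed_depth E /= (negPf ca) leq_subr.
  have le : size (nseq n c) <= n by rewrite size_nseq.
  pose t : kary_tree := Bseq le.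
  rewrite /eccentricity; apply: leq_trans (leq_bigmax t).
  apply: graph_dist_ge => [|p pp lp]; first exact: ltnW.
  have := signed_depth_path c pp; rewrite lp.
  have -> : signed_depth c t = n + n.
    rewrite /signed_depth /= size_nseq; case: (n) => [|m] /=; first by rewrite eqxx.
    by rewrite (_ : last c (nseq m c) = c) ?eqxx //; elim: m.
  by move: hc; lia.
- exists root_vertex; apply/bigmax_leqP => t _.
  have [p [pp lp sp]] := walk_to_root t.
  apply: leq_trans (size_bseq t); apply: graph_dist_le.
    by apply/has_walkP; exists p.
  exact: leq_ltn_trans (size_bseq t) ltG.
Qed.

End KaryTree.

(* An edge oriented by g from x to y gets the colour [phi x < phi y]: a
   monochromatic copy of the tree would contain a path of length n, directed
   away from the root, along which phi : G -> {0, ..., n-1} is strictly monotone. *)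
Lemma oriented_colouring_avoids n l (G : sgraph) (g : rel G) (phi : G -> nat) :
  oriented_colouring n l (@adj G) g phi ->
  exists c : {set G} -> bool, ~ mono_copy (kary_tree n l.+1) c.
Proof.
move=> [phin ge ga gl].
pose c (E : {set G}) := [exists x, exists y, [&& E == [set x; y], g x y & phi x < phi y]].
have cE x y : g x y -> c (edge x y) = (phi x < phi y).
  move=> gxy; apply/idP/idP => [|lt]; last first.
    by apply/existsP; exists x; apply/existsP; exists y; rewrite eqxx gxy.
  move=> /existsP[u /existsP[v /and3P[/eqP E guv lt]]].
  have /andP[_ nuv] := ge _ _ guv.
  have : u \in edge x y by rewrite E !inE eqxx.
  have : v \in edge x y by rewrite E !inE eqxx orbT.
  rewrite !inE => /orP[]/eqP ev /orP[]/eqP eu; subst u v; rewrite ?eqxx // in nuv *.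
  by have := ga _ _ gxy; rewrite guv.
exists c => -[f [col [finj fc]]].
(* Descend from the root along edges oriented by [g]: each step raises [phi] if [col] holds and
   lowers it otherwise. For [m = n] this leaves the range of [phi]. *)
have chain m : m <= n -> exists2 s : kary_tree n l.+1, size (s : kary_vertex n l.+1) = m &
    if col then m <= phi (f s) else phi (f s) + m < n.
  elim: m => [|m IH] ltmn.
    by exists (root_vertex n l.+1) => //; rewrite addn0 phin; case: col fc.
  have [s sm hs] := IH (ltnW ltmn).
  have ltsn : size (s : kary_vertex n l.+1) < n by rewrite sm.
  pose h i : kary_tree n l.+1 := cons_vertex i ltsn.
  have adjh i : adj (f s) (f (h i)) /\ c (edge (f s) (f (h i))) = col.
    by apply: fc; rewrite /= /kary_adj; apply/orP; left; apply: child_cons.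
  (* At most [l] of the [l.+1] children can fail to be out-neighbours. *)
  have [/existsP[i gi]|nog] := boolP [exists i, g (f s) (f (h i))].
    exists (h i); first by rewrite /= sm.
    have [_ ] := adjh i; rewrite cE // => colE.
    have /andP[_ ne] := ge _ _ gi.
    by move: hs; rewrite -colE; case: ltngtP ne => // lt _; lia.
  have hinj : injective (fun i => f (h i)) by move=> i j /finj/(congr1 val)[].
  have : #|'I_l.+1| <= l.
    rewrite -(card_imset _ hinj); apply: leq_trans (gl (f s)).
    apply: subset_leq_card; apply/subsetP => y /imsetP[i _ ->]; rewrite inE.
    have [-> _] := adjh i; move: nog; rewrite negb_exists => /forallP; exact.
  by rewrite card_ord ltnn.
have [s _] := chain n (leqnn n).
have := phin (f s); case: ifP => _; lia.
Qed.

Lemma K33_minor_mono (V : finType) (e e' : rel V) :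
  subrel e' e -> K33_minor e' -> K33_minor e.
Proof.
move=> se [A [B [AB dAB dABij tAB]]]; exists A, B; split=> // [i|i j].
  have cmono (C : {set V}) : connected_in e' C -> connected_in e C.
    move=> cC x y xC yC; apply: connect_sub (cC x y xC yC) => u v /and3P[uC vC euv].
    by apply: connect1; rewrite /= uC vC se.
  by have [? ? ? ?] := AB i; split=> //; apply: cmono.
by have /touchP[x [y [xA yB exy]]] := tAB i j; apply/touchP; exists x, y; split=> //; apply: se.
Qed.

(** * Adding an apex *)

Section ActiveApex.
Variables (V : finType) (e : rel V).
Hypothesis e_sym : symmetric e.

(** Isolated vertices are not joined to the apex; otherwise they would have degree 1 and count as
    light. *)
Definition active_apex : rel (option V) := fun u v =>
  match u, v with
  | Some x, Some y => e x y
  | Some x, None | None, Some x => 0 < degree e x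
  | None, None => false
  end.

Let Some_inj : injective (@Some V).
Proof. by move=> x y []. Qed.

Lemma degree_gt0 x y : e x y -> 0 < degree e x.
Proof. by move=> exy; apply/card_gt0P; exists y; rewrite inE. Qed.

Lemma degree_active x : degree active_apex (Some x) = (0 < degree e x) + degree e x.
Proof.
rewrite /degree (cardsD1 None) inE; congr (_ + _).
rewrite -[RHS](card_imset _ Some_inj); apply: eq_card => -[y|]; rewrite !inE /=.
  by rewrite mem_imset ?inE //; exact: Some_inj.
by symmetry; apply/negbTE/imsetP => -[].
Qed.

Lemma degree_le_apex x : degree e x <= degree active_apex None.
Proof.
rewrite /degree -(card_imset _ Some_inj); apply: subset_leq_card.
apply/subsetP => _ /imsetP[y + ->]; rewrite !inE /= => exy.
by apply: (@degree_gt0 y x); rewrite e_sym.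
Qed.

(* The apex raises the degree of every vertex which is not isolated by one, so
   that a vertex of degree at most 2 becomes one of degree at most 1. *)
Lemma light_active_apex l : 2 < l -> (exists x y, e x y) ->
  light 3 l active_apex -> light 2 l e.
Proof.
move=> l2 [x0 [y0 exy0]].
(* The degree of the apex bounds all degrees of [e], so if it is at most [l], every edge is
   light. *)
have lightNone : degree active_apex None <= l -> light 2 l e.
  by move=> h; right; exists x0, y0; split=> //; apply: leq_trans h; apply: degree_le_apex.
case=> [[[x|] /andP[dx dx3]]|[[x|] [[y|] [exy dx dy]]]] //=.
- left; exists x; move: dx dx3; rewrite degree_active; lia.
- by apply: lightNone; apply: ltnW; apply: leq_trans l2.
- right; exists x, y; split=> //; [apply: leq_trans dx | apply: leq_trans dy];
    by rewrite degree_active leq_addl.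
- exact: lightNone.
- exact: lightNone.
Qed.

End ActiveApex.

From mathcomp Require Import all_order all_algebra lra.

(** * Winding parity *)

Import Order.TTheory GRing.Theory Num.Theory.

Section Winding.
Local Open Scope ring_scope.
Variable R : realFieldType.
Implicit Types (u v w x y : R * R) (s t : seq (R * R)).

Definition near_by (d : R) u v : bool := (`|u.1 - v.1| < d) && (`|u.2 - v.2| < d).

(* [above u w] says that the vector u - w lies in the open upper half plane or
   on the positive half-axis: exactly one of u - w and w - u does. *)
Definition above u w : bool := (w.2 < u.2) || ((u.2 == w.2) && (w.1 < u.1)).

Lemma above_swap u w : u != w -> above w u = ~~ above u w.
Proof.
case: u w => [a b] [c d]; rewrite /above xpair_eqE /= => ne.
by case: (ltgtP b d) ne => [||_] //=; rewrite ?andbT; case: ltgtP.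
Qed.

(* Parity of the crossings of the positive half-axis when the vector u - w
   moves to u' - w' in one small step. *)
Definition crossing u w u' w' : bool := (above u w (+) above u' w') && (w.1 < u.1).

(** In [turn] the first point runs along a chain and the second is fixed; in [back_turn] the second
    one runs. *)
Fixpoint turn x s w : bool :=
  if s is y :: s' then crossing x w y w (+) turn y s' w else false.

Fixpoint back_turn u x s : bool :=
  if s is y :: s' then crossing u x u y (+) back_turn u y s' else false.

Variable d : R.
(** Moving both points by one step changes each coordinate of [u - w] by less than [d + d]. *)
Let far u w := ~~ near_by (d + d) u w.

(** The sign change bounds [y] and [y'] by [c], so [x] and [x'] have absolute value at least [c] and
    cannot differ in sign. *)
Lemma same_sign (c x y x' y' : R) : `|x - x'| < c -> `|y - y'| < c ->
  ~~ ((`|x| < c) && (`|y| < c)) -> ~~ ((`|x'| < c) && (`|y'| < c)) ->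
  y <= 0 -> 0 <= y' -> (0 < x) = (0 < x').
Proof.
move=> hx hy f f' y0 y0'.
have ny : `|y| < c by rewrite ler0_norm //; move: hy; rewrite ltr_norml => /andP[h _]; lra.
have ny' : `|y'| < c by rewrite ger0_norm //; move: hy; rewrite ltr_norml => /andP[h _]; lra.
move: f f'; rewrite ny ny' !andbT -!leNgt => f f'.
move: hx; rewrite ltr_norml => /andP[h1 h2].
case: (ltP 0 x) f => x0; case: (ltP 0 x') f' => x0' //.
  by rewrite ler0_norm // gtr0_norm // => *; lra.
by rewrite gtr0_norm // ler0_norm // => *; lra.
Qed.

Lemma same_side u w u' w' : near_by d u u' -> near_by d w w' ->
  far u w -> far u' w' -> above u w != above u' w' -> (w.1 < u.1) = (w'.1 < u'.1).
Proof.
move=> /andP[u1 u2] /andP[w1 w2] f f' h.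
have close (p q p' q' : R) : `|p - p'| < d -> `|q - q'| < d ->
    `|(p - q) - (p' - q')| < d + d.
  move=> hp hq; have -> : p - q - (p' - q') = (p - p') - (q - q') by lra.
  by apply: le_lt_trans (ler_normB _ _) _; apply: ltrD.
have cx := close _ _ _ _ u1 w1; have cy := close _ _ _ _ u2 w2.
rewrite -[w.1 < _]subr_gt0 -[w'.1 < _]subr_gt0.
have : (u.2 - w.2 <= 0) && (0 <= u'.2 - w'.2) || (u'.2 - w'.2 <= 0) && (0 <= u.2 - w.2).
  move: h; rewrite /above !subr_le0 !subr_ge0.
  by case: (ltgtP u.2 w.2); case: (ltgtP u'.2 w'.2).
case/orP => /andP[y0 y0']; first exact: same_sign cx cy f f' y0 y0'.
by symmetry; rewrite distrC in cx; rewrite distrC in cy; apply: same_sign cx cy f' f y0 y0'.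
Qed.

(** Discrete homotopy invariance: around one small cell of moves [u - w] stays away from 0, so it
    crosses the half-axis an even number of times. *)
Lemma crossing_cell u w u' w' : near_by d u u' -> near_by d w w' ->
  far u w -> far u' w -> far u w' -> far u' w' ->
  crossing u w u' w (+) crossing u w' u' w' = crossing u w u w' (+) crossing u' w u' w'.
Proof.
move=> nu nw f1 f2 f3 f4.
have d0 : 0 < d by case/andP: nu => h _; apply: le_lt_trans h; apply: normr_ge0.
have refl x : near_by d x x by rewrite /near_by !subrr !normr0 d0.
have sym x y : near_by d x y -> near_by d y x by rewrite /near_by !(distrC x.1) !(distrC x.2).
have := same_side nu (refl w) f1 f2; have := same_side (refl u) nw f1 f3.
have := same_side nu nw f1 f4; have := same_side nu (sym _ _ nw) f3 f2.
have := same_side (refl u') nw f2 f4; have := same_side nu (refl w') f3 f4.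
rewrite /crossing.
move: (above u w) (above u' w) (above u w') (above u' w').
move: (w.1 < u.1) (w.1 < u'.1) (w'.1 < u.1) (w'.1 < u'.1).
do 8 case => //=; do ?[by move/(_ isT)|move=> _ //].
Qed.

Lemma turn_strip u u' y t : near_by d u u' -> path (near_by d) y t ->
  all (far u) (y :: t) -> all (far u') (y :: t) ->
  crossing u y u' y (+) crossing u (last y t) u' (last y t) =
  back_turn u y t (+) back_turn u' y t.
Proof.
move=> nu; elim: t y => [|z t IH] y /=; first by rewrite addbb.
move=> /andP[nyz pt] /and3P[f1 f2 ft] /and3P[f3 f4 ft'].
have := IH z pt; rewrite /= f2 ft f4 ft' => /(_ isT isT) E.
rewrite addbACA -E -(crossing_cell nu nyz) //.
by rewrite [RHS]addbA addbK.
Qed.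

(** Sum over all cells of the product of the two chains; interior sides cancel. *)
Lemma turn_square x s y t : path (near_by d) x s -> path (near_by d) y t ->
  (forall u w, u \in x :: s -> w \in y :: t -> far u w) ->
  turn x s y (+) turn x s (last y t) = back_turn x y t (+) back_turn (last x s) y t.
Proof.
elim: s x => [|z s IH] x /=; first by rewrite addbb.
move=> /andP[nxz ps] pt f.
have fx : all (far x) (y :: t) by apply/allP => w; apply: f; rewrite mem_head.
have fz : all (far z) (y :: t) by apply/allP => w; apply: f; rewrite !inE eqxx orbT.
have E := IH z ps pt (fun u w us => f u w (mem_behead (s := x :: z :: s) us)).
by rewrite addbACA E (turn_strip nxz pt fx fz) addbA addbK.
Qed.

(** The left side counts crossings of the negative half-axis by [x - w], [back_turn] those of the
    positive one. Together they are all changes of [above], whose parity is read off at the ends. *)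
Lemma turn_back x y t : path (near_by d) y t ->
  (forall w, w \in y :: t -> far x w) ->
  turn y t x = back_turn x y t (+) (above x y (+) above x (last y t)).
Proof.
elim: t y => [|z t IH] y /=; first by rewrite addbb.
move=> /andP[nyz pt] f.
have fy := f y (mem_head _ _); have fz : far x z by apply: f; rewrite !inE eqxx orbT.
rewrite IH //; last by move=> w wt; apply: f; rewrite inE wt orbT.
have d0 : 0 < d by case/andP: nyz => h _; apply: le_lt_trans h; apply: normr_ge0.
have ne w : far x w -> x != w.
  by apply: contraNneq => ->; rewrite /near_by !subrr !normr0 addr_gt0.
have side : above x y != above x z -> x.1 != y.1.
  move: fy nyz; rewrite /far /near_by /above !ltr_norml !negb_and -!leNgt.
  move=> f1 /andP[_ /andP[p1 p2]] h; apply/negP => /eqP E.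
  have : `|x.2 - y.2| < d + d.
    rewrite ltr_norml; case: (ltgtP y.2 x.2) h => h1; case: (ltgtP z.2 x.2) => h2 //= _;
    by apply/andP; split; lra.
  by rewrite ltr_norml => /andP[q1 q2]; case/orP: f1 => /orP[] f1; lra.
rewrite /crossing (above_swap (ne _ fy)) (above_swap (ne _ fz)).
case: (above x y) (above x z) side => [] [] //= side; try by move: (side isT);
  case: ltgtP => //= _ _; case: (back_turn _ _ _); case: (above _ _).
Qed.

Lemma winding_relation x s y t :
  path (near_by d) x s -> path (near_by d) y t ->
  (forall u w, u \in x :: s -> w \in y :: t -> far u w) ->
  turn x s y (+) turn x s (last y t) (+) (turn y t x (+) turn y t (last x s)) =
  (above x y (+) above x (last y t)) (+) (above (last x s) y (+) above (last x s) (last y t)).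
Proof.
move=> ps pt f; rewrite turn_square //.
have bx := turn_back pt (fun w => f x w (mem_head _ _)).
have bl := turn_back pt (fun w => f (last x s) w (mem_last _ _)).
by rewrite bx bl [X in _ (+) X]addbACA addbA addbb addFb.
Qed.

End Winding.

(* van Kampen: summing the winding relation over the 18 pairs of independent
   edges, every winding occurs twice, and so does every comparison of two
   vertices except those among the b's. *)
Lemma K33_chains (R : realFieldType) (d : R) (a b : 'I_3 -> R * R)
    (s : 'I_3 -> 'I_3 -> seq (R * R)) :
  (0 < d)%R ->
  (forall i j, path (near_by d) (a i) (s i j)) ->
  (forall i j, last (a i) (s i j) = b j) ->
  ~ (forall i j k l, i != k -> j != l -> forall u w,
       u \in a i :: s i j -> w \in a k :: s k l -> ~~ near_by (d + d)%R u w).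
Proof.
move=> d0 ps ls far.
pose A i j k := turn (a i) (s i j) (a k); pose B i j k := turn (a i) (s i j) (b k).
pose P i k := above (a i) (a k); pose Q i k := above (a i) (b k).
pose S i k := above (b i) (a k); pose T i k := above (b i) (b k).
have E i j k l : i != k -> j != l ->
    A i j k (+) B i j l (+) (A k l i (+) B k l j) =
    (P i k (+) Q i l) (+) (S j k (+) T j l).
  move=> ik jl; have := winding_relation (ps i j) (ps k l) (far i j k l ik jl).
  by rewrite !ls.
have TN j l : j != l -> T l j = ~~ T j l.
  move=> jl; apply: above_swap; apply/eqP => bjl.
  have jin : b j \in a ord0 :: s ord0 j by rewrite -(ls ord0 j) mem_last.
  have lin : b l \in a ord_max :: s ord_max l by rewrite -(ls ord_max l) mem_last.
  have := far ord0 j ord_max l isT jl _ _ jin lin.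
  by rewrite bjl /near_by !subrr !normr0 addr_gt0.
pose i0 : 'I_3 := inord 0; pose i1 : 'I_3 := inord 1; pose i2 : 'I_3 := inord 2.
have n01 : i0 != i1 by rewrite -val_eqE /= !inordK.
have n02 : i0 != i2 by rewrite -val_eqE /= !inordK.
have n12 : i1 != i2 by rewrite -val_eqE /= !inordK.
have n10 : i1 != i0 by rewrite eq_sym.
have n20 : i2 != i0 by rewrite eq_sym.
have n21 : i2 != i1 by rewrite eq_sym.
pose sum := (fun X : 'I_3 -> 'I_3 -> 'I_3 -> 'I_3 -> bool => [::
  X i0 i0 i1 i1; X i0 i0 i1 i2; X i0 i1 i1 i0; X i0 i1 i1 i2; X i0 i2 i1 i0; X i0 i2 i1 i1;
  X i0 i0 i2 i1; X i0 i0 i2 i2; X i0 i1 i2 i0; X i0 i1 i2 i2; X i0 i2 i2 i0; X i0 i2 i2 i1;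
  X i1 i0 i2 i1; X i1 i0 i2 i2; X i1 i1 i2 i0; X i1 i1 i2 i2; X i1 i2 i2 i0; X i1 i2 i2 i1]).
have : foldr addb false (sum (fun i j k l => A i j k (+) B i j l (+) (A k l i (+) B k l j))) =
   foldr addb false (sum (fun i j k l => (P i k (+) Q i l) (+) (S j k (+) T j l))).
  by rewrite /sum !E.
(* Each [T j l] with [j != l] occurs three times, and [T j l], [T l j] are complementary: the three
   pairs contribute nine, an odd number. *)
rewrite /sum /= (TN _ _ n01) (TN _ _ n02) (TN _ _ n12) => {}E.
(* The identities are checked by [ring] in the Boolean ring, with [xorb] as addition. *)
have xorE x y : x (+) y = xorb x y by case: x; case: y.
have negE x : ~~ x = xorb true x by case: x.
rewrite !xorE !negE in E.
match type of E with ?l = ?r =>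
  (have L1 : l = false by ring); (have L2 : r = true by ring); by rewrite L1 L2 in E
end.
Qed.

From mathcomp Require Import all_classical all_reals all_analysis.

(** * Drawings in the plane *)

Import numFieldNormedType.Exports.

(** * Chains and continua *)

Section Topology.
Local Open Scope classical_set_scope.
Local Open Scope ring_scope.

(** The points of [A] satisfying [P] form a relatively open and closed subset. *)
Lemma connected_local (T : topologicalType) (A P : set T) :
  connected A ->
  (forall z, A z -> \forall z' \near z, A z' -> (P z <-> P z')) ->
  forall p q, A p -> A q -> P p -> P q.
Proof.
move=> cA loc p q Ap Aq Pp.
pose N z := [set z' | A z' -> (P z <-> P z')].
have Nz z : A z -> (N z)° z by move=> /loc; rewrite /interior /=.
have NP z z' : (N z)° z' -> A z' -> (P z <-> P z') by move=> /interior_subset; apply.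
suff : (A `&` P) q by case.
rewrite (cA (A `&` P)) //.
- by exists p.
- exists (\bigcup_(z in A `&` P) (N z)°); first by apply: bigcup_open => z _; apply: open_interior.
  apply/seteqP; split=> z.
    by move=> [Az Pz]; split=> //; exists z => //; apply: Nz.
  by move=> [Az [w [Aw Pw] /NP/(_ Az)]] h; split=> //; apply/h.
- exists (~` \bigcup_(z in A `&` ~` P) (N z)°).
    by apply: open_closedC; apply: bigcup_open => z _; apply: open_interior.
  apply/seteqP; split=> z.
    move=> [Az Pz]; split=> // -[w [Aw Pw] /NP/(_ Az)] h; by apply: Pw; apply/h.
  move=> [Az h]; split=> //; apply: contrapT => Pz; apply: h; exists z => //; exact: Nz.
Qed.

Section Plane.
Variable R : realType.
Implicit Types (p q : R * R) (K L D : set (R * R)).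

Lemma near_byE d p q : near_by d p q <-> ball p d q.
Proof. by split=> [/andP[]|[h1 h2]]; [split|apply/andP; split]. Qed.

Lemma connected_chain K d p q : 0 < d -> connected K -> K p -> K q ->
  exists s, [/\ path (near_by d) p s, last p s = q & forall z, z \in s -> K z].
Proof.
move=> d0 cK Kp Kq.
pose P z := exists s, [/\ path (near_by d) p s, last p s = z & forall z, z \in s -> K z].
apply: (connected_local (P := P) cK _ Kp Kq); last by exists [::].
move=> z Kz.
have : \forall z' \near z, ball z d z' by exact: nbhsx_ballx.
apply: filterS => z' zz' Kz'.
have ext u v : K v -> near_by d u v -> P u -> P v.
  move=> Kv uv [s [ps ls sK]]; exists (rcons s v).
  rewrite rcons_path last_rcons ps ls uv; split=> // w.
  by rewrite mem_rcons inE => /orP[/eqP->|/sK].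
split; apply: ext => //; apply/near_byE => //; exact: ball_sym.
Qed.

Lemma separated_compacts K L : compact K -> compact L -> K `&` L = set0 ->
  \forall d \near 0^'+, forall p q, K p -> L q -> ~~ near_by (d + d) p q.
Proof.
move=> /compact_near_coveringP cK cL KL.
have clL : closed L by apply: compact_closed => //; exact: norm_hausdorff.
suff h p : K p -> \forall p' \near p & d \near 0^'+, forall q, L q -> ~~ near_by (d + d) p' q.
  have FF : Filter (0 : R)^'+ by typeclasses eauto.
  have := cK _ (0^'+) (fun d p => forall q, L q -> ~~ near_by (d + d) p q) FF h.
  by apply: filterS => d hd p' q Kp'; apply: hd.
move=> Kp.
have : nbhs p (~` L).
  apply: open_nbhs_nbhs; split; first exact: closed_openC.
  by move=> Lp; have : (K `&` L) p by []; rewrite KL.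
move=> /nbhs_ballP[r /= r0 rL].
(* With [d] below [r / 4], the distances [r / 4] and [d + d] add up to less than [r]. *)
have r4 : 0 < r / 4 by rewrite divr_gt0.
exists (ball p (r / 4), [set d | 0 < d < r / 4]) => /=.
  split; first exact: nbhsx_ballx.
  near=> d; apply/andP; split; near: d; [exact: nbhs_right_gt | exact: nbhs_right_lt].
move=> [p' d] /= [pp' /andP[d0 dr]] q Lq; apply/negP => /near_byE p'q.
apply: (rL q) => //; have := ball_triangle pp' p'q; apply: le_ball; lra.
Unshelve. all: by end_near.
Qed.

Lemma segment_continuum (c z : R * R) r : ball c r z ->
  exists K, [/\ compact K, connected K, K c, K z & K `<=` ball c r].
Proof.
move=> cz; pose f (t : R) : R * R := c + t *: (z - c).
have fc : continuous f.
  move=> t; apply: cvgD; first exact: cvg_cst.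
  by apply: cvgZr_tmp; exact: cvg_id.
exists (f @` `[0, 1]); split.
- by apply: continuous_compact; [apply: continuous_subspaceT | apply: segment_compact].
- apply: connected_continuous_connected; first exact: segment_connected.
  exact: continuous_subspaceT.
- by exists 0; rewrite /f ?scale0r ?addr0 //= in_itv /= lexx ler01.
- by exists 1; rewrite /f ?scale1r ?subrKC //= in_itv /= lexx ler01.
- move=> _ [t + <-]; rewrite /= in_itv /= => /andP[t0 t1]; move: cz.
  rewrite -!ball_normE /= /f opprD addNKr normrN normrZ distrC => cz.
  rewrite ger0_norm //; apply: le_lt_trans cz; rewrite ler_piMl //.
Qed.

(** Being joined to [p] by a continuum in [D] is locally constant, since segments in small balls can
    be adjoined. *)
Lemma continuum_in_component D F p q : open D -> connected F -> F `<=` D ->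
  F p -> F q ->
  exists K, [/\ compact K, connected K, K p, K q & K `<=` D].
Proof.
move=> oD cF FD Fp Fq.
pose P z := exists K, [/\ compact K, connected K, K p, K z & K `<=` D].
apply: (connected_local (P := P) cF _ Fp Fq); last first.
  by exists [set p]; split=> //; [exact: compact_set1 | exact: connected1 | move=> _ ->; apply: FD].
move=> z Fz; have : nbhs z D by apply: open_nbhs_nbhs; split=> //; apply: FD.
move=> /nbhs_ballP[r /= r0 rD]; have : \forall z' \near z, ball z r z' by exact: nbhsx_ballx.
apply: filterS => z' /segment_continuum[L [kL cL Lz Lz' LB]] _.
have ext u v : L u -> L v -> P u -> P v.
  move=> Lu Lv [K [kK cK Kp Ku KD]]; exists (K `|` L); split.
  - exact: compactU.
  - by apply: connectedU => //; exists u.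
  - by left.
  - by right.
  - by move=> w [/KD|/LB/rD].
by split; apply: ext.
Qed.


(* Only vertex-disjoint edges are required to have disjoint arcs, as in the
   Hanani-Tutte theorem, and the arcs may be arbitrary continua. *)
Definition weak_drawing (V : finType) (e : rel V) (pos : V -> R * R)
    (arc : V -> V -> set (R * R)) : Prop :=
  (forall x y, e x y ->
     [/\ compact (arc x y), connected (arc x y), arc x y (pos x) & arc x y (pos y)]) /\
  (forall x y z t, e x y -> e z t -> x != z -> x != t -> y != z -> y != t ->
     arc x y `&` arc z t = set0).

Section WeakDrawing.
Variables (V : finType) (e : rel V) (pos : V -> R * R) (arc : V -> V -> set (R * R)).
Hypotheses (e_sym : symmetric e) (drawing : weak_drawing e pos arc).

Let arcs_in (C : {set V}) : set (R * R) :=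
  [set p | exists x y, [/\ x \in C, y \in C, e x y & arc x y p]].

Lemma path_chain d (C : {set V}) x y s : 0 < d ->
  path [rel u v | [&& u \in C, v \in C & e u v]] x (y :: s) ->
  exists c, [/\ path (near_by d) (pos x) c, last (pos x) c = pos (last y s) &
                forall p, p \in pos x :: c -> arcs_in C p].
Proof.
move=> d0; have [geo _] := drawing.
have step u v : [&& u \in C, v \in C & e u v] ->
  exists c, [/\ path (near_by d) (pos u) c, last (pos u) c = pos v &
                forall p, p \in pos u :: c -> arcs_in C p].
  move=> /and3P[uC vC euv]; have [_ ca au av] := geo _ _ euv.
  have [c [pc lc sc]] := connected_chain d0 ca au av; exists c; split=> // p.
  by rewrite inE => /orP[/eqP->|/sc h]; exists u, v.
elim: s x y => [|z s IH] x y /=; first by rewrite andbT => /step.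
move=> /andP[/step[c [pc lc sc]] /IH[c' [pc' lc' sc']]].
exists (c ++ c'); rewrite cat_path last_cat lc pc; split=> // p.
rewrite -cat_cons mem_cat => /orP[/sc//|pc2]; apply: sc'.
by rewrite inE pc2 orbT.
Qed.

(** Nothing is contracted: a path inside [A i :|: B j] between chosen representatives is followed
    along its arcs. Independent pairs of indices use disjoint vertex sets, hence disjoint arcs. *)
Lemma weak_drawing_K33_minor_free : ~ K33_minor e.
Proof.
move=> [A [B [AB dAB dABij touchAB]]]; have [geo dis] := drawing.
have rep (F : 'I_3 -> {set V}) : (forall i, F i != finset.set0) -> exists f, forall i, f i \in F i.
  move=> ne; have ex i : exists x, x \in F i by apply/set0Pn.
  by have [f Ff] := choice ex; exists f.
have [a aA] : exists f, forall i, f i \in A i by apply: rep => i; have [] := AB i.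
have [b bB] : exists f, forall i, f i \in B i by apply: rep => i; have [] := AB i.
pose C i j := (A i :|: B j)%SET.
have disC i j k l x : i != k -> j != l -> x \in C i j -> x \notin C k l.
  move=> /dAB[dA _] /dAB[_ dB]; rewrite !inE negb_or => /orP[xA|xB].
    by rewrite (disjointFr dA xA) (disjointFr (dABij i l) xA).
  by rewrite (disjointFr dB xB) (disjointFl (dABij k j) xB).
have sep x y z t : \forall d \near (0 : R)^'+, e x y -> e z t ->
    x != z -> x != t -> y != z -> y != t ->
    forall p q, arc x y p -> arc z t q -> ~~ near_by (d + d) p q.
  have [/and5P[exy ezt xz xt /andP[yz yt]]|no] :=
      boolP [&& e x y, e z t, x != z, x != t & (y != z) && (y != t)]; last first.
    by near=> d => exy ezt xz xt yz yt; rewrite exy ezt xz xt yz yt in no.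
  have [cxy _ _ _] := geo _ _ exy; have [czt _ _ _] := geo _ _ ezt.
  have := separated_compacts cxy czt (dis _ _ _ _ exy ezt xz xt yz yt).
  by apply: filterS => d h _ _ _ _ _ _.
have far : \forall d \near (0 : R)^'+, forall x y z t, e x y -> e z t ->
    x != z -> x != t -> y != z -> y != t ->
    forall p q, arc x y p -> arc z t q -> ~~ near_by (d + d) p q.
  have FF : Filter (0 : R)^'+ by typeclasses eauto.
  have := filter_forall FF (fun u : V * V * (V * V) => sep u.1.1 u.1.2 u.2.1 u.2.2).
  by apply: filterS => d h x y z t; apply: (h (x, y, (z, t))).
have [d [d0 {}far]] : exists d : R, 0 < d /\ forall x y z t, e x y -> e z t ->
    x != z -> x != t -> y != z -> y != t ->
    forall p q, arc x y p -> arc z t q -> ~~ near_by (d + d) p q.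
  near (0 : R)^'+ => d; exists d; split; first by near: d; exact: nbhs_right_gt.
  by near: d.
have chains (ij : 'I_3 * 'I_3) : exists c, [/\ path (near_by d) (pos (a ij.1)) c,
    last (pos (a ij.1)) c = pos (b ij.2) &
    forall p, p \in pos (a ij.1) :: c -> arcs_in (C ij.1 ij.2) p].
  case: ij => i j /=; have [_ _ cA _] := AB i; have [_ _ _ cB] := AB j.
  have := connected_inU e_sym cA cB (touchAB i j).
  move=> /(_ (a i) (b j)); rewrite !inE aA bB orbT => /(_ isT isT)/connectP[s ps lastE].
  case: s ps lastE => [_ /= E|y s ps /= ->]; last exact: path_chain ps.
  by have := bB j; rewrite E (disjointFr (dABij i j) (aA i)).
have [c hc] := choice chains.
apply: (@K33_chains _ d (pos \o a) (pos \o b) (fun i j => c (i, j))) => //=.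
- by move=> i j; have [] := hc (i, j).
- by move=> i j; have [] := hc (i, j).
- move=> i j k l ik jl u w uc wc.
  have [_ _ /(_ _ uc)[x [y [xC yC exy au]]]] := hc (i, j).
  have [_ _ /(_ _ wc)[z [t [zC tC ezt aw]]]] := hc (k, l).
  have ne v v' : v \in C i j -> v' \in C k l -> v != v'.
    by move=> vC; apply: contraTneq => <-; apply: disC vC.
  by apply: far exy ezt _ _ _ _ _ _ au aw; apply: ne.
Unshelve. all: by end_near.
Qed.

End WeakDrawing.

Definition apex (V : finType) (e : rel V) : rel (option V) := fun u v =>
  match u, v with
  | Some x, Some y => e x y
  | None, None => false
  | _, _ => true
  end.

Section Drawings.
Variable G : sgraph.

Lemma edgeP (E : {set G}) : reflect (exists x y, adj x y /\ E = edge x y) (E \in edges G).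
Proof.
apply: (iffP imsetP) => [[[x y]]|[x [y [xy ->]]]]; first by rewrite inE => xy ->; exists x, y.
by exists (x, y); rewrite ?inE.
Qed.

Lemma edge_edges (x y : G) : adj x y -> edge x y \in edges G.
Proof. by move=> xy; apply/edgeP; exists x, y. Qed.

Lemma arc_continuum (A : set (R * R)) p q : is_arc A p q ->
  [/\ compact A, connected A, A p & A q].
Proof.
move=> [g [cg _ <- <- ->]]; split.
- by apply: continuous_compact => //; apply: segment_compact.
- by apply: connected_continuous_connected => //; apply: segment_connected.
- by exists 0 => //=; rewrite in_itv /= lexx ler01.
- by exists 1 => //=; rewrite in_itv /= lexx ler01.
Qed.

Lemma drawing_arcs_disjoint pos arc (x y z t : G) : @is_drawing R G pos arc ->
  adj x y -> adj z t -> x != z -> x != t -> y != z -> y != t ->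
  arc (edge x y) `&` arc (edge z t) = set0.
Proof.
move=> dr xy zt xz xt yz yt; apply/seteqP; split=> // p [p1 p2].
have ne : edge x y != edge z t.
  apply/eqP => /setP/(_ x); by rewrite !inE eqxx (negPf xz) (negPf xt).
have [w []] := drawing_cross dr (edge_edges xy) (edge_edges zt) ne p1 p2.
rewrite !inE => /orP[]/eqP->; by rewrite ?(negPf xz) ?(negPf xt) ?(negPf yz) ?(negPf yt).
Qed.

Lemma planar_K33_minor_free : planar R G -> ~ K33_minor (@adj G).
Proof.
move=> [pos [arc dr]].
apply: (@weak_drawing_K33_minor_free _ _ pos (fun x y => arc (edge x y)) (@adj_sym G)).
split=> [x y xy|x y z t]; first exact: arc_continuum (drawing_arc dr xy).
exact: (drawing_arcs_disjoint dr).
Qed.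

Lemma drawing_closed pos arc : @is_drawing R G pos arc -> closed (drawing_points pos arc).
Proof.
move=> dr; apply: closedU.
  apply: compact_closed; first exact: norm_hausdorff.
  by apply: finite_compact; apply: finite_image; apply: finite_finset.
apply: closed_bigcup; first exact: finite_finset.
move=> E /edgeP[x [y [xy ->]]]; apply: compact_closed; first exact: norm_hausdorff.
by have [] := arc_continuum (drawing_arc dr xy).
Qed.

(* A point q0 of the outer face serves as the position of the apex. *)
Lemma outer_face_continuum pos arc F q0 (x : G) : @is_drawing R G pos arc ->
  connected F -> F `<=` ~` drawing_points pos arc -> F q0 -> closure F (pos x) ->
  exists K, [/\ compact K, connected K, K q0, K (pos x) &
    forall E, E \in edges G -> x \notin E -> arc E `&` K = set0].
Proof.
move=> dr cF FD Fq0 clx.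
(* A small ball around [pos x] misses all arcs not incident to [x]. Go from [q0] to a point of the
   face in this ball outside the drawing, then straight to [pos x]; the segment may meet only arcs
   at [x]. *)
pose far := \bigcup_(E in [set E | E \in edges G /\ x \notin E]) arc E.
have clfar : closed far.
  apply: closed_bigcup; first exact: finite_finset.
  move=> E [/edgeP[u [v [uv ->]]] _]; apply: compact_closed; first exact: norm_hausdorff.
  by have [] := arc_continuum (drawing_arc dr uv).
have : nbhs (pos x) (~` far).
  apply: open_nbhs_nbhs; split; first exact: closed_openC.
  by move=> [E [Eed xE]] /(drawing_vertex dr Eed); rewrite (negPf xE).
move=> /nbhs_ballP[r /= r0 rfar].
have [q [Fq xq]] := clx _ (nbhsx_ballx (pos x) r r0).
have [K [kK cK Kq0 Kq KD]] :=
  continuum_in_component (closed_openC (drawing_closed dr)) cF FD Fq0 Fq.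
have [L [kL cL Lx Lq Lr]] := segment_continuum xq.
exists (K `|` L); split.
- exact: compactU.
- by apply: connectedU => //; exists q.
- by left.
- by right.
- move=> E Eed xE; apply/seteqP; split=> // p [Ep [/KD|/Lr/rfar]].
    by apply; right; exists E.
  by apply; exists E.
Qed.

(** The continua [K x] serve as arcs of the apex edges. They may meet each other, because all these
    edges share the apex. *)
Lemma outerplanar_K33_minor_free : outerplanar R G -> ~ K33_minor (apex (@adj G)).
Proof.
move=> [pos [arc [dr [F [[[q0 Dq0 FE] _] clF]]]]].
have Fq0 : F q0 by rewrite FE; apply: connected_component_refl.
have cF : connected F by rewrite FE; apply: component_connected.
have FD : F `<=` ~` drawing_points pos arc by rewrite FE; apply: connected_component_sub.
have [K hK] := choice (fun x => outer_face_continuum dr cF FD Fq0 (clF x)).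
pose pos' u := if u is Some x then pos x else q0.
pose arc' u v := match u, v with
  | Some x, Some y => arc (edge x y) | Some x, None | None, Some x => K x
  | None, None => set0 end.
apply: (@weak_drawing_K33_minor_free _ _ pos' arc').
  by move=> [x|] [y|] //=; rewrite adj_sym.
split.
  move=> [x|] [y|] //=.
  - by move=> xy; apply: arc_continuum (drawing_arc dr xy).
  - by have [? ? ? ?] := hK x.
  - by have [? ? ? ?] := hK y.
have disj x y z : adj x y -> x != z -> y != z -> arc (edge x y) `&` K z = set0.
  move=> xy xz yz; have [_ _ _ _] := hK z; apply; first exact: edge_edges.
  by rewrite !inE ![z == _]eq_sym (negPf xz) (negPf yz).
move=> [x|] [y|] [z|] [t|] //=; rewrite ?eqxx //.
- by move=> xy zt; apply: (drawing_arcs_disjoint dr).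
- by move=> xy _ xz _ yz _; apply: disj.
- by move=> xy _ _ xt _ yt; apply: disj.
- by move=> _ zt xz xt _ _; rewrite setIC; apply: disj; rewrite // eq_sym.
- by move=> _ zt _ _ yz yt; rewrite setIC; apply: disj; rewrite // eq_sym.
Qed.

End Drawings.
End Plane.

End Topology.

Theorem theorem2 (R : realType) :
  (exists T : sgraph, is_tree T /\ graph_radius T = 3 /\ planar_avoidable R T) /\
  (exists T : sgraph, is_tree T /\ graph_radius T = 2 /\ outerplanar_avoidable R T).
Proof.
have [l l2 lightK33] := K33_minor_free_light.
split.
- exists (kary_tree 3 l.+1); split; first exact: kary_tree_is_tree.
  split=> [|G plG]; first exact: kary_tree_radius (leqW (ltnW l2)).
  suff [g [phi col]] : exists g phi, oriented_colouring 3 l (@adj G) g phi.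
    exact: oriented_colouring_avoids col.
  apply: light_oriented_colouring; [by []|exact: leqW|exact: adj_sym|exact: adj_irr|].
  move=> e' se es ex; apply: lightK33 => //.
    by move=> x; apply/negP => /se; rewrite adj_irr.
  by move=> /(K33_minor_mono se); apply: planar_K33_minor_free plG.
- exists (kary_tree 2 l.+1); split; first exact: kary_tree_is_tree.
  split=> [|G plG]; first exact: kary_tree_radius (leqW (ltnW l2)).
  suff [g [phi col]] : exists g phi, oriented_colouring 2 l (@adj G) g phi.
    exact: oriented_colouring_avoids col.
  apply: light_oriented_colouring; [by []|exact: leqW (ltnW l2)|exact: adj_sym|exact: adj_irr|].
  (* The apex is added to each subgraph [e'] separately; the result lies inside the full cone over
     [G], so it has no K_{3,3} minor. *)
  move=> e' se es ex; apply: (light_active_apex es l2 ex); apply: lightK33.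
  + by move=> [x|] [y|] //=; apply: es.
  + by move=> [x|] //=; apply/negP => /se; rewrite adj_irr.
  + have sa : subrel (active_apex e') (apex (@adj G)) by move=> [x|] [y|] //= /se.
    by move=> /(K33_minor_mono sa); apply: outerplanar_K33_minor_free plG.
  + by have [x [y exy]] := ex; exists (Some x), (Some y).
Qed.
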